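(* Let $d\ge2$ and $n\ge1$ be integers, and let $X$ be a Banach lattice of functions on $\mathbb{R}^d$ such that $$L^\infty_c(\mathbb{R}^d)\subseteq X\hookrightarrow L^1_{loc}(\mathbb{R}^d).$$ Then there are constants $C_1,C_2>0$ such that for every smooth compactly supported radial function $f(x)=g(r(x))$ on $\mathbb{R}^d$, $$C_1\sum_{k=0}^n\sum_{j=0}^{\lfloor k/2\rfloor}\|(\mathcal{D}^jg)^{(k-2j)}(r(x))\|_X\le\|f\|_{W^n_0X(\mathbb{R}^d)}\le C_2\sum_{k=0}^n\sum_{j=0}^{\lfloor k/2\rfloor}\|(\mathcal{D}^jg)^{(k-2j)}(r(x))\|_X,$$ where $\|f\|_{W^n_0X(\mathbb{R}^d)}=\sum_{k=0}^n\|\nabla^kf\|_X$.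
   Context: For $x\in\mathbb{R}^d$, $r(x)=\sqrt{x_1^2+\dots+x_d^2}$. A radial function is one of the form $f(x)=g(r(x))$, with radial profile $g(t)=f(t\mathbf{e}_1)$, $t\in\mathbb{R}$, where $\mathbf{e}_1$ is the first canonical basis vector; $g$ is smooth and even when $f$ is smooth. A Banach lattice of functions on $\mathbb{R}^d$ is a Banach space $X$ of (equivalence classes of) measurable functions on $\mathbb{R}^d$ whose norm has the lattice property: if $f\in X$ and $|g|\le|f|$ a.e., then $g\in X$ and $\|g\|_X\le\|f\|_X$. $L^\infty_c(\mathbb{R}^d)$ denotes the bounded measurable functions supported on compact sets. $X\hookrightarrow L^1_{loc}(\mathbb{R}^d)$ means that for every compact $K\subseteq\mathbb{R}^d$ there is a constant $C_K$ with $\|f\|_{L^1(K)}\le C_K\|f\|_X$ for all $f\in X$. $\|\nabla^kf(x)\|_F=\bigl(\sum_{i_1,\dots,i_k=1}^d(\partial^kf(x)/\partial x_{i_1}\cdots\partial x_{i_k})^2\bigr)^{1/2}$ is the Frobenius norm of the tensor of all $k$-th order partial derivatives (for $k=0$ it is $|f(x)|$), and $\|\nabla^kf\|_X$ abbreviates $\|\,\|\nabla^kf\|_F\|_X$. $\mathcal{D}g(r)=g'(r)/r$ (for $r\ne0$); $\mathcal{D}^j$ is its $j$-fold iteration ($\mathcal{D}^0g=g$); $(\cdot)^{(m)}$ is the $m$-th ordinary derivative. $\|h(r(x))\|_X$ is the $X$-norm of the function $x\mapsto h(r(x))$. *)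

(* Defs.v *)
From HB Require Import structures.
From mathcomp Require Import all_boot all_order all_algebra.
From mathcomp Require Import all_classical all_reals all_analysis.
Set Implicit Arguments.
Unset Strict Implicit.
Unset Printing Implicit Defensive.
Import Order.TTheory GRing.Theory Num.Theory.
Import numFieldNormedType.Exports.
Local Open Scope classical_set_scope.
Local Open Scope ring_scope.

(* R^d is 'rV[R]_d. Its library norm is the max norm, which gives the usual
   topology; the Euclidean length is [radius] below. *)

Section lebesgue.
Context (R : realType) (d : nat).
Implicit Types (A : set 'rV[R]_d) (o : option ('rV[R]_d * 'rV[R]_d)).

(* The half-open box with corners a and b, empty unless a < b coordinatewise;
   [None] is the empty box, needed only because for d = 0 every product box is
   a point of volume 1. *)
Definition box o : set 'rV[R]_d :=
  if o is Some (a, b) then [set x | forall i, a 0 i < x 0 i <= b 0 i]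
  else set0.

Definition box_volume o : R :=
  if o is Some (a, b) then \prod_(i < d) Num.max 0 (b 0 i - a 0 i) else 0.

Definition box_cover A (B : nat -> option ('rV[R]_d * 'rV[R]_d)) : Prop :=
  A `<=` \bigcup_k box (B k).

Definition lebesgue_outer A : \bar R :=
  ereal_inf [set (\sum_(k <oo) (box_volume (B k))%:E)%E | B in box_cover A].

Local Open Scope ereal_scope.

Lemma box_volume_ge0 o : 0 <= (box_volume o)%:E.
Proof.
case: o => [[a b]|//]; rewrite lee_fin; apply: prodr_ge0 => i _.
by rewrite le_max lexx.
Qed.

Lemma lebesgue_outer_ge0 A : 0 <= lebesgue_outer A.
Proof.
apply: le_ereal_inf_tmp => _ [B _ <-].
by apply: nneseries_ge0 => k _ _; exact: box_volume_ge0.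
Qed.

Lemma lebesgue_outer0 : lebesgue_outer set0 = 0.
Proof.
apply/eqP; rewrite eq_le lebesgue_outer_ge0 andbT.
apply: ereal_inf_lbound; exists (fun=> None) => //=.
by rewrite eseries0.
Qed.

Lemma le_lebesgue_outer :
  {homo lebesgue_outer : A B / A `<=` B >-> A <= B}.
Proof.
move=> A B AB; apply/ereal_inf_le_tmp => x [C BC <-{x}].
by exists C => //; exact: subset_trans AB BC.
Qed.

Lemma lebesgue_outer_sigma_subadditive : sigma_subadditive lebesgue_outer.
Proof.
move=> A; have [[i ioo]|] := pselect (exists i, lebesgue_outer (A i) = +oo).
  rewrite (eseries_pinfty _ _ ioo) ?leey// => n _.
  by rewrite -ltNye (lt_le_trans _ (lebesgue_outer_ge0 _)).
rewrite -forallNE => Aoo.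
suff add2e (e : {posnum R}) : lebesgue_outer (\bigcup_n A n) <=
    \sum_(i <oo) lebesgue_outer (A i) + e%:num%:E.
  by apply/lee_addgt0Pr => _/posnumP[].
rewrite (le_trans _ (epsilon_trick _ _ _))//; last first.
  by move=> n; exact: lebesgue_outer_ge0.
pose v o := (box_volume o)%:E.
have v0 o : 0 <= v o by exact: box_volume_ge0.
pose P n B := box_cover (A n) B /\
  \sum_(k <oo) v (B k) <= lebesgue_outer (A n) + (e%:num / (2 ^ n.+1)%:R)%:E.
have [G PG] : {G : nat -> nat -> option ('rV[R]_d * 'rV[R]_d) &
    forall n, P n (G n)}.
  apply: (@choice _ _ P) => n.
  have en1 : (0 < e%:num / (2 ^ n.+1)%:R)%R by [].
  have fin : lebesgue_outer (A n) \is a fin_num.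
    rewrite ge0_fin_numE ?lebesgue_outer_ge0// ltey.
    by apply/eqP; exact: Aoo.
  have [_ [B AB <-] vB] := lb_ereal_inf_adherent en1 fin.
  by exists B; split => //; exact: ltW.
have vG_ge0 x : 0 <= (v \o uncurry G) x by exact: v0.
apply: (@le_trans _ _ (\esum_(i in setT) (v \o uncurry G) i)).
  apply: ereal_inf_lbound => /=.
  have /card_esym/ppcard_eqP[f] := card_nat2.
  exists (uncurry G \o f).
    move=> t [i _] /(PG i).1 -[j _ Bijt]; exists (f^-1%FUN (i, j)) => //=.
    by rewrite invK ?inE.
  rewrite -(esum_pred_image (v \o uncurry G) _ xpredT) ?[fun=> _]set_true//.
  by rewrite image_eq.
rewrite (_ : esum _ _ = \sum_(i <oo) \sum_(j <oo) v (G i j)); last first.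
  pose J : nat -> set (nat * nat) := fun i => [set (i, j) | j in setT].
  rewrite (_ : setT = \bigcup_k J k); last first.
    by rewrite predeqE => -[a b]; split => // _; exists a => //; exists b.
  rewrite esum_bigcupT /=; last 2 first.
    - apply/trivIsetP => i j _ _ ij.
      rewrite predeqE => -[n m] /=; split => //= -[] [_] _ [<-{n} _].
      by move=> [m' _] [] /esym/eqP; rewrite (negbTE ij).
    - by move=> /= [n m]; exact: v0.
  rewrite -(image_id [set: nat]) -fun_true esum_pred_image//; last first.
    by move=> n _; exact: esum_ge0.
  apply: eq_eseriesr => /= j _.
  rewrite -(esum_pred_image (v \o uncurry G) (pair j) predT)//=; last first.
    by move=> ? ? _ _; exact: (@can_inj _ _ _ snd).
  by congr esum; rewrite predeqE => -[a b]; split; move=> [i _ <-]; exists i.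
apply: lee_lim.
- apply: is_cvg_nneseries => n *.
  by apply: nneseries_ge0 => m *; exact: (vG_ge0 (n, m)).
- apply: is_cvg_nneseries => n *; apply: adde_ge0 => //.
  exact: lebesgue_outer_ge0.
- by near=> n; apply: lee_sum => i _; exact: (PG i).2.
Unshelve. all: by end_near. Qed.

HB.instance Definition _ := isOuterMeasure.Build R 'rV[R]_d lebesgue_outer
  lebesgue_outer0 lebesgue_outer_ge0 le_lebesgue_outer
  lebesgue_outer_sigma_subadditive.

Definition lebesgue_outer_measure : {outer_measure set 'rV[R]_d -> \bar R} :=
  lebesgue_outer.

End lebesgue.

(* R^d with the sigma-algebra of Lebesgue measurable sets. *)
Notation lebesgue_space R d := (caratheodory_type (lebesgue_outer_measure R d)).

Definition lebesgue_measure_Rd (R : realType) (d : nat) :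
    {measure set (lebesgue_space R d) -> \bar R} :=
  (lebesgue_outer_measure R d : set (lebesgue_space R d) -> \bar R).

Section functions.
Context (R : realType) (d : nat).
Implicit Types (f g : 'rV[R]_d -> R).

Definition lebesgue_measurable f : Prop :=
  measurable_fun [set: lebesgue_space R d] (f : lebesgue_space R d -> R).

Definition compactly_supported f : Prop :=
  exists2 K : set 'rV[R]_d, compact K & forall x, ~ K x -> f x = 0.

Definition Linfty_c f : Prop :=
  [/\ lebesgue_measurable f, exists M : R, forall x, `|f x| <= M &
      compactly_supported f].

(* Equivalence classes are handled through representatives: membership and
   norm are a.e.-invariant by [lattice_carrier] and [lattice_norm]. The value
   of the norm outside of the carrier is unspecified. *)
Record banach_lattice := BanachLattice {
  carrier : set ('rV[R]_d -> R) ;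
  lnorm : ('rV[R]_d -> R) -> R ;
  carrier_measurable : forall f, carrier f -> lebesgue_measurable f ;
  carrier0 : carrier (fun=> 0) ;
  carrierD : forall f g,
    carrier f -> carrier g -> carrier (fun x => f x + g x) ;
  carrierZ : forall (a : R) f, carrier f -> carrier (fun x => a * f x) ;
  lnorm_ge0 : forall f, carrier f -> 0 <= lnorm f ;
  lnorm_eq0 : forall f, carrier f -> lnorm f = 0 ->
    \forall x \ae lebesgue_measure_Rd R d, f x = 0 ;
  lnormZ : forall (a : R) f, carrier f ->
    lnorm (fun x => a * f x) = `|a| * lnorm f ;
  lnormD : forall f g, carrier f -> carrier g ->
    lnorm (fun x => f x + g x) <= lnorm f + lnorm g ;
  lattice_carrier : forall f g, carrier f -> lebesgue_measurable g ->
    (\forall x \ae lebesgue_measure_Rd R d, `|g x| <= `|f x|) -> carrier g ;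
  lattice_norm : forall f g, carrier f -> lebesgue_measurable g ->
    (\forall x \ae lebesgue_measure_Rd R d, `|g x| <= `|f x|) ->
    lnorm g <= lnorm f ;
  lnorm_complete : forall u : nat -> 'rV[R]_d -> R,
    (forall n, carrier (u n)) ->
    (forall e : R, 0 < e -> exists N, forall m n, (N <= m)%N -> (N <= n)%N ->
      lnorm (fun x => u m x - u n x) < e) ->
    exists2 f, carrier f & lnorm (fun x => u n x - f x) @[n --> \oo] --> 0
}.

Definition embeds_L1loc (X : banach_lattice) : Prop :=
  forall K : set 'rV[R]_d, compact K -> exists C : R, forall f, carrier X f ->
    (\int[lebesgue_measure_Rd R d]_(x in (K : set (lebesgue_space R d)))
       `|f x|%:E <= (C * lnorm X f)%:E)%E.

Definition pderiv (i : 'I_d) f : 'rV[R]_d -> R := 'D_(delta_mx 0 i) f.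

Definition pderivs (s : seq 'I_d) f : 'rV[R]_d -> R := foldr pderiv f s.

Definition smooth f : Prop := forall s : seq 'I_d,
  continuous (pderivs s f) /\
  forall i x, derivable (pderivs s f) x (delta_mx 0 i).

Definition frobenius_grad (k : nat) f (x : 'rV[R]_d) : R :=
  Num.sqrt (\sum_(s : k.-tuple 'I_d) pderivs s f x ^+ 2).

Definition sobolev_norm (X : banach_lattice) (n : nat) f : R :=
  \sum_(k < n.+1) lnorm X (frobenius_grad k f).

Definition radius (x : 'rV[R]_d) : R := Num.sqrt (\sum_(i < d) x 0 i ^+ 2).

(* First canonical basis vector, written so as to make sense for every d. *)
Definition e1 : 'rV[R]_d := \row_(i < d) (val i == 0%N)%:R.

Definition profile f (t : R) : R := f (t *: e1).

Definition radial f : Prop :=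
  exists g : R -> R, forall x, f x = g (radius x).

End functions.

(* The value at t = 0 is irrelevant below: D^j g is only used at t != 0 or up
   to the null set {0} of R^d, and differentiation is local. *)
Definition Dop (R : realType) (g : R -> R) (t : R) : R := derive1 g t / t.

Definition radial_norm (R : realType) (d : nat) (X : banach_lattice R d)
    (n : nat) (g : R -> R) : R :=
  \sum_(k < n.+1) \sum_(j < (k./2).+1)
    lnorm X (fun x => derive1n (k - j.*2) (iter j (@Dop R) g) (radius x)).

(* Main.v *)
Require Import Defs.
From mathcomp Require Import all_boot all_order all_algebra.
From mathcomp Require Import all_classical all_reals all_analysis.
From mathcomp Require Import ring lra zify.
Import Order.TTheory GRing.Theory Num.Theory.
Import numFieldNormedType.Exports.
Local Open Scope classical_set_scope.
Local Open Scope ring_scope.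

(** The two norms are already comparable order by order and point by point.
Fix k and x <> 0, put r = |x| and let D denote the operator [Dop]. Compare
the three families

  - A_j = (D^j g)^(k - 2j) (r), for 2j <= k,
  - B_l = r^(2l - k) (D^l g)(r), for k <= 2l <= 2k,
  - the partial derivatives of order k of f at x.

Writing f as a function of |x|^2 / 2, on which D acts as the plain derivative,
repeated use of d_i (h(r)) = x_i (D h)(r) and of the product rule produces only
terms P(x) (D^l g)(r) with P homogeneous of degree 2l - k
([pderivs_radial]); hence the partial derivatives are bounded by the B_l
([pderivs_upper]). The same computation on the half-line gives
A_j = sum_l hermite (k - 2j) l * B_(l + j) ([derive1n_Dop]); this is a
unitriangular system, so the A_j and the B_l bound each other
([hermite_system_le], [hermite_system_ge]). This is the upper estimate
([frobenius_upper]).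

For the lower estimate, contract the tensor of order k with a unit vector w
in all its slots. If the scalar product of x and w is t r, the result is
sum_l hermite k l * t^(2l - k) * B_l ([contraction_radial]), and it is at most
a constant times the Frobenius norm. As d >= 2, every t in [0, 1] occurs
([exists_unit_direction]). Multiplied by t^k this is a polynomial in t^2 that
is bounded on [0, 1], so its coefficients are bounded ([interpolation_bound]);
as the Hermite coefficients are positive integers, so are the B_l
([frobenius_lower]).

The origin is a null set and all the functions involved are continuous
elsewhere, hence measurable; the pointwise estimates therefore pass to the
lattice norm ([lnorm_dominated]), starting from the fact that the Frobenius
norm of a derivative of a test function is bounded, measurable and compactly
supported. *)

(* The name also denotes the radius of a ball. *)
Local Notation radius := Defs.radius.

(** * Derivatives of a smooth function of one positive variable *)

(** The coefficient of s^(2l - m) in the m-th Hermite polynomial, up to sign: the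
number of ways of choosing m - l disjoint pairs among m points. It counts the
ways in which m derivatives, applied to a function of s^2 / 2, can hit factors
s produced by earlier ones. *)
Fixpoint hermite (m l : nat) : nat :=
  if m is m'.+1 then
    ((if l is l'.+1 then hermite m' l' else 0) + hermite m' l * (l.*2 - m'))%N
  else (l == 0)%N.

Lemma hermite_small m l : (l.*2 < m)%N -> hermite m l = 0%N.
Proof.
elim: m l => [//|m IH] l lm /=.
have -> : (l.*2 - m = 0)%N by lia.
rewrite muln0 addn0; case: l lm => [//|l] lm; apply: IH; lia.
Qed.

Lemma hermite_large m l : (m < l)%N -> hermite m l = 0%N.
Proof.
elim: m l => [|m IH] l lm /=; first by case: l lm.
rewrite (IH l) ?mul0n ?addn0; last lia.
by case: l lm => [//|l] lm; apply: IH; lia.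
Qed.

Lemma hermite_diag m : hermite m m = 1%N.
Proof. by elim: m => [//|m IH] /=; rewrite IH hermite_large. Qed.

Lemma hermite_gt0 m l : (m <= l.*2)%N -> (l <= m)%N -> (0 < hermite m l)%N.
Proof.
elim: m l => [|m IH] l ml lm; first by case: l ml lm.
rewrite /= addn_gt0; have [lm'|lm'] := leqP l m; last first.
  by have -> : l = m.+1 by [lia]; rewrite hermite_diag.
by rewrite orbC muln_gt0 IH //=; lia.
Qed.

(** One more derivative: s^(2l - m) a_l becomes s^(2l - m) (s a_(l + 1)) +
(2l - m) s^(2l - m - 1) a_l. Both the half-line and the contraction formula
are inductions on this identity. The truncated subtraction is harmless because
the coefficients vanish for 2l < m. *)
Lemma hermite_sum (R : comNzRingType) m (s : R) (a : nat -> R) :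
  \sum_(l < m.+2) (hermite m.+1 l)%:R * s ^+ (l.*2 - m.+1) * a l =
  \sum_(l < m.+1) (hermite m l)%:R * (s ^+ (l.*2 - m) * (s * a l.+1) +
     (l.*2 - m)%:R * s ^+ (l.*2 - m).-1 * a l).
Proof.
under [RHS]eq_bigr do rewrite mulrDr.
rewrite big_split /=.
under eq_bigr do rewrite natrD 2!mulrDl; rewrite big_split /=.
congr (_ + _).
  rewrite big_ord_recl /= 2!mul0r add0r; apply: eq_bigr => i _ /=.
  have [im|im] := ltnP i.*2 m; first by rewrite hermite_small // !mul0r.
  rewrite /bump leq0n add1n.
  have -> : (i.+1.*2 - m.+1 = (i.*2 - m).+1)%N by lia.
  by rewrite exprSr; ring.
rewrite big_ord_recr /= hermite_large // mul0n !mul0r addr0.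
apply: eq_bigr => i _; rewrite natrM !mulrA.
by congr (_ * _ ^+ _ * _); lia.
Qed.

Section PointwiseRules.
Context {R : realType} {V : normedModType R}.
Implicit Types (f g : V -> R) (x v : V).

Lemma is_derive_add f g x v a b : is_derive x v f a -> is_derive x v g b ->
  is_derive x v (fun y => f y + g y) (a + b).
Proof. exact: is_deriveD. Qed.

Lemma is_derive_mul f g x v a b : is_derive x v f a -> is_derive x v g b ->
  is_derive x v (fun y => f y * g y) (a * g x + f x * b).
Proof.
move=> df dg; have := is_deriveM df dg.
by rewrite /GRing.scale /= addrC [g x * a]mulrC.
Qed.

Lemma is_derive_scale c f x v a : is_derive x v f a ->
  is_derive x v (fun y => c * f y) (c * a).
Proof. exact: is_deriveZ. Qed.

Lemma is_derive_exp f n x v a : is_derive x v f a ->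
  is_derive x v (fun y => f y ^+ n) (n%:R * f x ^+ n.-1 * a).
Proof. by move=> df; have := is_deriveX n df; rewrite exprfctE. Qed.

Lemma is_derive_bigsum (I : Type) (r : seq I) (f : I -> V -> R) x v (a : I -> R) :
  (forall i, is_derive x v (f i) (a i)) ->
  is_derive x v (fun y => \sum_(i <- r) f i y) (\sum_(i <- r) a i).
Proof.
move=> df; elim: r => [|i r IH].
  by under eq_fun do rewrite big_nil; rewrite big_nil; exact: is_derive_cst.
under eq_fun do rewrite big_cons; rewrite big_cons.
exact: is_derive_add.
Qed.

(** Reduces directional derivatives to one variable, where the chain rule needs
no differentiability of f beyond the direction v. *)
Lemma is_derive_line f x v a :
  is_derive x v f a <-> is_derive (0 : R) 1 (fun s : R => f (s *: v + x)) a.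
Proof.
have E : 'D_v f x = 'D_1 (fun s : R => f (s *: v + x)) 0.
  rewrite /derive; set u1 := fun e => e^-1 *: _; set u2 := fun e => e^-1 *: _.
  suff -> : u1 = u2 by [].
  by rewrite funeqE /u1 /u2 => e /=; rewrite addr0 scale0r add0r [_%:A]mulr1.
split=> -[dv <-]; apply: DeriveDef => //.
- by move/derivable1P : dv.
- by apply/derivable1P.
Qed.

Lemma is_derive_outer f (h : R -> R) x v a b :
  is_derive x v f a -> is_derive (f x) 1 h b ->
  is_derive x v (fun y => h (f y)) (b * a).
Proof.
move=> /is_derive_line df dh; apply/is_derive_line.
by apply: is_derive1_comp; rewrite scale0r add0r.
Qed.

End PointwiseRules.

Section OneVariable.
Context {R : realType}.
Implicit Types (g h F G : R -> R) (t : R).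

(** The functions that agree on the positive half-line with a combination of
products of a derivative of g and a negative power. The class is stable under
differentiation and division by the variable, hence under [Dop], and its
members are derivable on the half-line: this is why all iterates of [Dop] are
smooth there. *)
Inductive jet_laurent g : (R -> R) -> Prop :=
| JetMonomial i j (c : R) : jet_laurent g (fun t => c * (derive1n i g t * t^-1 ^+ j))
| JetAdd F G : jet_laurent g F -> jet_laurent g G ->
    jet_laurent g (fun t => F t + G t)
| JetExt F G : (forall t, 0 < t -> F t = G t) ->
    jet_laurent g F -> jet_laurent g G.

Lemma gt0_near t : 0 < t -> \forall s \near t, 0 < s.
Proof. exact: lt_nbhsr. Qed.

Lemma derive1_eq_gt0 F G t : 0 < t -> (forall s, 0 < s -> F s = G s) ->
  derive1 F t = derive1 G t.
Proof.
move=> t0 FG; rewrite !derive1E; apply: near_eq_derive.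
by apply: filterS (gt0_near _ t0) => s; exact: FG.
Qed.

Lemma derivable_eq_gt0 F G t : 0 < t -> (forall s, 0 < s -> F s = G s) ->
  derivable F t 1 -> derivable G t 1.
Proof.
move=> t0 FG; apply: near_eq_derivable.
by apply: filterS (gt0_near _ t0) => s; exact: FG.
Qed.

Lemma derivable_derive1_is F t : derivable F t 1 -> is_derive t 1 F (derive1 F t).
Proof. by move=> ?; rewrite derive1E; exact: derivableP. Qed.

Variable g : R -> R.
Hypothesis g_smooth : forall i t, derivable (derive1n i g) t 1.

Lemma jet_laurent_derive F : jet_laurent g F ->
  (forall t, 0 < t -> derivable F t 1) /\ jet_laurent g (derive1 F).
Proof.
elim=> [i j c|{}F G _ [dF JF] _ [dG JG]|{}F G FG _ [dF JF]].
- have d t : 0 < t -> is_derive t 1 (fun t => c * (derive1n i g t * t^-1 ^+ j))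
    (c * (derive1n i.+1 g t * t^-1 ^+ j) +
     (- (c * j%:R)) * (derive1n i g t * t^-1 ^+ j.+1)).
    move=> t0; have gt := derivable_derive1_is _ _ (g_smooth i t).
    have tn : t != 0 by rewrite gt_eqF.
    have dV : is_derive t 1 (@GRing.inv R) (- t ^- 2).
      have := is_deriveV (f := id) tn (is_derive_id t (1 : R)).
      by rewrite /GRing.scale /= mulr1.
    have := is_derive_scale c _ _ _ _
      (is_derive_mul _ _ _ _ _ _ gt (is_derive_exp _ j _ _ _ dV)).
    move/is_derive_eq; apply; rewrite -exprVn.
    by case: j => [|j]; rewrite /= ?exprS; ring.
  split=> [t t0|]; first by have [] := d t t0.
  apply: (JetExt _ _ _ _ (JetAdd _ _ _ (JetMonomial _ i.+1 j c)
            (JetMonomial _ i j.+1 (- (c * j%:R))))) => t t0.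
  by rewrite derive1E; have [_ ->] := d t t0.
- split=> [t t0|]; first by apply: derivableD; [exact: dF|exact: dG].
  apply: (JetExt _ _ _ _ (JetAdd _ _ _ JF JG)) => t t0.
  rewrite !derive1E; apply/esym.
  exact: (deriveD (f := F) (g := G) (dF t t0) (dG t t0)).
- split=> [t t0|]; first by apply: (derivable_eq_gt0 F G) => //; exact: dF.
  by apply: JetExt JF => t t0; exact: derive1_eq_gt0.
Qed.

Lemma jet_laurent_div F : jet_laurent g F -> jet_laurent g (fun t => F t / t).
Proof.
elim=> [i j c|{}F G _ JF _ JG|{}F G FG _ JF].
- by apply: (JetExt _ _ _ _ (JetMonomial _ i j.+1 c)) => t _; rewrite exprSr !mulrA.
- by apply: (JetExt _ _ _ _ (JetAdd _ _ _ JF JG)) => t _; rewrite mulrDl.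
- by apply: JetExt JF => t t0; rewrite FG.
Qed.

Lemma jet_laurent_Dop j : jet_laurent g (iter j (@Dop R) g).
Proof.
elim: j => [|j IH] /=.
  by apply: (JetExt _ _ _ _ (JetMonomial g 0 0 1)) => t _; rewrite mul1r mulr1.
by apply: jet_laurent_div; have [] := jet_laurent_derive _ IH.
Qed.

Lemma jet_laurent_derive1n F m : jet_laurent g F -> jet_laurent g (derive1n m F).
Proof. by move=> JF; elim: m => [//|m IH]; have [] := jet_laurent_derive _ IH. Qed.

Lemma is_derive_Dop j t : 0 < t ->
  is_derive t 1 (iter j (@Dop R) g) (t * iter j.+1 (@Dop R) g t).
Proof.
move=> t0; have [d _] := jet_laurent_derive _ (jet_laurent_Dop j).
have := derivable_derive1_is _ _ (d t t0).
by rewrite /= {2}/Dop mulrC divfK ?gt_eqF.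
Qed.

(** The expansion of ordinary derivatives in powers of [Dop], started at an
iterate so that it covers all terms of the radial norm. *)
Lemma derive1n_Dop m j t : 0 < t ->
  derive1n m (iter j (@Dop R) g) t =
  \sum_(l < m.+1) (hermite m l)%:R * t ^+ (l.*2 - m) * iter (l + j) (@Dop R) g t.
Proof.
elim: m t => [|m IH] t t0.
  by rewrite big_ord1 /= mul1r expr0 mul1r.
rewrite derive1nS (derive1_eq_gt0 _ _ _ t0 IH) derive1E.
rewrite (hermite_sum _ _ _ (fun l => iter (l + j) (@Dop R) g t)).
apply: derive_val; apply: is_derive_bigsum => l.
have := is_derive_mul _ _ _ _ _ _ (is_derive_scale (hermite m l)%:R _ _ _ _
  (is_derive_exp id (l.*2 - m) t 1 1 (is_derive_id _ _)))
  (is_derive_Dop (l + j) t t0).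
by move/is_derive_eq; apply; rewrite addSn /=; ring.
Qed.

End OneVariable.

(** * Two quantitative facts of linear algebra *)

Section Bounds.
Context {R : realType}.

Lemma bigsum_le n (c b : 'I_n -> R) (M : R) : (forall i, `|b i| <= M) ->
  `|\sum_(i < n) c i * b i| <= (\sum_(i < n) `|c i|) * M.
Proof.
move=> bM; apply: le_trans (ler_norm_sum _ _ _) _.
rewrite mulr_suml; apply: ler_sum => i _.
by rewrite normrM; apply: ler_wpM2l.
Qed.

(** The coefficients are recovered from the values at N equally spaced nodes by
the inverse of a Vandermonde matrix, whose entries do not depend on the
polynomial. *)
Lemma interpolation_bound N : exists2 C : R, 0 <= C &
  forall (c : nat -> R) (M : R),
    (forall s, 0 <= s <= 1 -> `|\sum_(i < N) c i * s ^+ i| <= M) ->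
    forall i, (i < N)%N -> `|c i| <= C * M.
Proof.
pose node : 'rV[R]_N := \row_(j < N) (j%:R / N%:R).
pose V := Vandermonde N node.
have node01 (j : 'I_N) : 0 <= node 0 j <= 1.
  have N0 : (0 < N)%N by exact: leq_ltn_trans (leq0n j) (ltn_ord j).
  rewrite mxE divr_ge0 //= ler_pdivrMr ?ltr0n // mul1r ler_nat.
  exact/ltnW.
have uV : V \in unitmx.
  rewrite unitmxE det_Vandermonde unitfE.
  apply/prodf_neq0 => i _; apply/prodf_neq0 => j ij.
  have N0 : (0 < N)%N by exact: leq_ltn_trans (leq0n i) (ltn_ord i).
  rewrite !mxE -mulrBl mulf_neq0 ?invr_eq0 ?pnatr_eq0 -?lt0n //.
  by rewrite subr_eq0 eqr_nat gtn_eqF.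
exists (\sum_(i < N) \sum_(j < N) `|invmx V j i|).
  by apply: sumr_ge0 => i _; apply: sumr_ge0.
move=> c M cM i iN; pose a : 'rV[R]_N := \row_(i < N) c i.
have aV (j : 'I_N) : `|(a *m V) 0 j| <= M.
  have -> : (a *m V) 0 j = \sum_(i < N) c i * node 0 j ^+ i.
    by rewrite [LHS]mxE; apply: eq_bigr => k _; rewrite !mxE.
  exact: cM.
have -> : c i = \sum_(j < N) invmx V j (Ordinal iN) * (a *m V) 0 j.
  have : (a *m V *m invmx V) 0 (Ordinal iN) = c i by rewrite mulmxK // mxE.
  by rewrite mxE => <-; apply: eq_bigr => j _; rewrite mulrC.
apply: le_trans (bigsum_le _ _ _ _ aV) _.
have M0 : 0 <= M by apply: le_trans (aV (Ordinal iN)).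
apply: ler_wpM2r => //.
rewrite [leRHS](bigD1 (Ordinal iN)) //= lerDl.
by apply: sumr_ge0 => k _; apply: sumr_ge0.
Qed.

Section Triangular.
Variable k : nat.

(** The relation between the two families (D^j g)^(k - 2j) (t) and
t^(2l - k) D^l g (t); abstracting it from g makes the constants below uniform
in g and t. *)
Definition hermite_system (a b : nat -> R) := forall j, (j.*2 <= k)%N ->
  a j = \sum_(l < (k - j.*2).+1) (hermite (k - j.*2) l)%:R * b (l + j)%N.

Lemma hermite_system_le : exists2 C : R, 0 <= C &
  forall a b M, hermite_system a b -> 0 <= M ->
    (forall l, (k <= l.*2)%N -> (l <= k)%N -> `|b l| <= M) ->
    forall j, (j.*2 <= k)%N -> `|a j| <= C * M.
Proof.
exists (\sum_(j < k.+1) \sum_(l < (k - j.*2).+1) (hermite (k - j.*2) l)%:R).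
  by apply: sumr_ge0 => j _; apply: sumr_ge0.
move=> a b M ab M0 bM j jk; rewrite ab //.
have jk' : (j < k.+1)%N by lia.
apply: (@le_trans _ _ ((\sum_(l < (k - j.*2).+1) (hermite (k - j.*2) l)%:R) * M)).
  rewrite mulr_suml; apply: le_trans (ler_norm_sum _ _ _) _; apply: ler_sum => l _.
  rewrite normrM normr_nat.
  have [lk|kl] := ltnP l.*2 (k - j.*2); first by rewrite hermite_small // !mul0r.
  apply: ler_wpM2l => //; apply: bM; first lia.
  have := ltn_ord l; lia.
apply: ler_wpM2r => //; rewrite [leRHS](bigD1 (Ordinal jk')) //= lerDl.
by apply: sumr_ge0 => i _; apply: sumr_ge0.
Qed.

(** The equation of index j has leading unknown b (k - j) with coefficient 1, so
back substitution solves the system for increasing l. *)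
Lemma hermite_system_ge : exists2 C : R, 0 <= C &
  forall a b M, hermite_system a b -> 0 <= M ->
    (forall j, (j.*2 <= k)%N -> `|a j| <= M) ->
    forall l, (k <= l.*2)%N -> (l <= k)%N -> `|b l| <= C * M.
Proof.
suff main N : exists2 C : R, 0 <= C &
  forall a b M, hermite_system a b -> 0 <= M ->
    (forall j, (j.*2 <= k)%N -> `|a j| <= M) ->
    forall l, (l < N)%N -> (k <= l.*2)%N -> (l <= k)%N -> `|b l| <= C * M.
  have [C C0 HC] := main k.+1; exists C => // a b M ab M0 aM l kl lk.
  exact: (HC a b).
elim: N => [|N [C C0 HC]]; first by exists 0.
pose m := (k - (k - N).*2)%N.
pose S : R := \sum_(l < m) (hermite m l)%:R.
have S0 : 0 <= S by apply: sumr_ge0.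
have SC0 : 0 <= S * C by exact: mulr_ge0.
exists (C + (1 + S * C)) => [|a b M ab M0 aM l lN kl lk].
  by rewrite !addr_ge0.
move: lN; rewrite ltnS leq_eqVlt => /orP[/eqP lN|lN]; last first.
  apply: le_trans (HC a b M ab M0 aM l lN kl lk) _.
  by rewrite ler_wpM2r // lerDl addr_ge0.
(* Solve the equation of index k - N for its last unknown b N. *)
have jk : ((k - N).*2 <= k)%N by lia.
have := ab _ jk; rewrite -/m big_ord_recr /= hermite_diag mul1r.
have -> : (m + (k - N) = l)%N by rewrite /m; lia.
move=> al; rewrite -[b l](addKr (\sum_(i < m) (hermite m i)%:R * b (i + (k - N))%N)) -al addrC.
apply: le_trans (ler_normB _ _) _; rewrite !mulrDl mul1r.
rewrite addrC ler_wpDl ?mulr_ge0 // addrC lerD //; first exact: aM.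
rewrite -mulrA mulr_suml; apply: le_trans (ler_norm_sum _ _ _) _; apply: ler_sum => i _.
rewrite normrM normr_nat.
have [ik|ki] := ltnP i.*2 m; first by rewrite hermite_small // !mul0r.
apply: ler_wpM2l => //; have im := ltn_ord i; apply: (HC a b) => //.
- by move: im; rewrite /m; lia.
- by move: im ki; rewrite /m; lia.
- by move: im ki; rewrite /m; lia.
Qed.

End Triangular.

Lemma hermite_system_radial (g : R -> R) (t : R) k : 0 < t ->
  (forall i t, derivable (derive1n i g) t 1) ->
  hermite_system k (fun j => derive1n (k - j.*2) (iter j (@Dop R) g) t)
    (fun l => t ^+ (l.*2 - k) * iter l (@Dop R) g t).
Proof.
move=> t0 gs j jk; rewrite derive1n_Dop //; apply: eq_bigr => l _.
by rewrite -mulrA; congr (_ * (_ ^+ _ * _)); lia.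
Qed.

End Bounds.

(** * Partial derivatives of radial functions *)

Section Radial.
Context {R : realType} {d : nat}.
Implicit Types (x v w : 'rV[R]_d) (f P Q : 'rV[R]_d -> R) (g h : R -> R).

Lemma is_derive_coord x v i : is_derive x v (fun y => y 0 i) (v 0 i).
Proof.
apply/is_derive_line.
have -> : (fun s : R => (s *: v + x) 0 i) = fun s => s * v 0 i + x 0 i.
  by apply/funext => s; rewrite !mxE.
have := is_derive_add _ _ _ _ _ _ (is_derive_mul _ _ _ _ _ _
  (is_derive_id (0 : R) (1 : R)) (is_derive_cst (v 0 i) (0 : R) (1 : R)))
  (is_derive_cst (x 0 i) (0 : R) (1 : R)).
by move/is_derive_eq; apply; rewrite mul1r mulr0 !addr0.
Qed.

Definition sqnorm x : R := \sum_(i < d) x 0 i ^+ 2.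
Definition dot x w : R := \sum_(i < d) x 0 i * w 0 i.

Lemma sqnorm_ge0 x : 0 <= sqnorm x.
Proof. by apply: sumr_ge0 => i _; exact: sqr_ge0. Qed.

Lemma radius_ge0 x : 0 <= radius x.
Proof. exact: sqrtr_ge0. Qed.

Lemma sqr_radius x : radius x ^+ 2 = sqnorm x.
Proof. by rewrite /radius sqr_sqrtr // sqnorm_ge0. Qed.

Lemma radius_gt0 x : x != 0 -> 0 < radius x.
Proof.
move=> x0; rewrite lt_def radius_ge0 andbT; apply: contra x0 => /eqP r0.
have /eqP : sqnorm x = 0 by rewrite -sqr_radius r0 expr0n.
rewrite psumr_eq0 => [/allP x0|i _]; last exact: sqr_ge0.
apply/eqP/rowP => i; rewrite mxE; apply/eqP.
by rewrite -sqrf_eq0; exact: x0 (mem_index_enum i).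
Qed.

Lemma coord_le_radius x i : `|x 0 i| <= radius x.
Proof.
rewrite -(ler_pXn2r (n := 2)) ?nnegrE ?radius_ge0 // sqr_radius real_normK ?num_real //.
by rewrite /sqnorm (bigD1 i) //= lerDl; apply: sumr_ge0 => j _; exact: sqr_ge0.
Qed.

Lemma neq0_near x : x != 0 -> \forall y \near x, y != 0.
Proof.
by move=> x0; apply: (@cvgr_neq0 _ _ _ (nbhs x) _ id x) => //; exact: cvg_id.
Qed.

Lemma is_derive_radius x v : x != 0 ->
  is_derive x v (@radius R d) (dot x v / radius x).
Proof.
move=> x0; have r0 := radius_gt0 _ x0.
have dS : is_derive x v sqnorm (\sum_(i < d) 2 * (x 0 i * v 0 i)).
  apply: is_derive_bigsum => i.
  have := is_derive_exp _ 2 _ _ _ (is_derive_coord x v i).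
  by move/is_derive_eq; apply; rewrite /=; ring.
have s0 : 0 < sqnorm x by rewrite -sqr_radius exprn_gt0.
have := is_derive_outer _ _ _ _ _ _ dS (is_derive1_sqrt s0).
move/is_derive_eq; apply; rewrite -mulr_sumr -/(dot x v) -/(radius x).
by rewrite invfM mulrACA mulVf // mul1r mulrC.
Qed.

(** Stated with h'(r) = r a, that is a = (D h)(r): then the singular factor 1 / r
of the gradient of the radius disappears. *)
Lemma is_derive_comp_radius h x v a : x != 0 ->
  is_derive (radius x) 1 h (radius x * a) ->
  is_derive x v (fun y => h (radius y)) (dot x v * a).
Proof.
move=> x0 dh; have r0 := radius_gt0 _ x0.
have := is_derive_outer _ _ _ _ _ _ (is_derive_radius _ v x0) dh.
by move/is_derive_eq; apply; field; rewrite gt_eqF.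
Qed.

Lemma dot_delta x i : dot x (delta_mx 0 i) = x 0 i.
Proof.
rewrite /dot (bigD1 i) //= big1 ?addr0 ?mxE ?eqxx ?mulr1 // => j ji.
by rewrite mxE (negbTE ji) mulr0.
Qed.

(** Homogeneous polynomial functions of degree m. The zero function has every
degree, so that differentiation lowers the degree by one without exception. *)
Inductive homog : nat -> ('rV[R]_d -> R) -> Prop :=
| HomogConst c : homog 0 (fun=> c)
| HomogZero m : homog m (fun=> 0)
| HomogCoord i m P : homog m P -> homog m.+1 (fun x => x 0 i * P x)
| HomogAdd m P Q : homog m P -> homog m Q -> homog m (fun x => P x + Q x).

Lemma homog_bound m P : homog m P ->
  exists2 C : R, 0 <= C & forall x, `|P x| <= C * radius x ^+ m.
Proof.
elim=> [c|{}m|i {}m {}P _ [C C0 HC]|{}m {}P Q _ [C C0 HC] _ [D D0 HD]].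
- by exists `|c| => // x; rewrite mulr1.
- by exists 0 => // x; rewrite normr0 mul0r.
- exists C => // x; rewrite normrM exprS mulrCA.
  by apply: ler_pM => //; exact: coord_le_radius.
- exists (C + D) => [|x]; first exact: addr_ge0.
  by rewrite mulrDl; apply: le_trans (ler_normD _ _) (lerD (HC x) (HD x)).
Qed.

Lemma pderiv_cst (i : 'I_d) (c : R) : pderiv i (fun=> c) = fun=> 0.
Proof. by apply/funext => x; exact: derive_cst. Qed.

(** The last clause separates degree 0, where m.-1 = m says too little. *)
Lemma homog_derive m P i : homog m P ->
  [/\ forall x, derivable P x (delta_mx 0 i),
      homog m.-1 (pderiv i P) &
      m = 0%N -> forall x, pderiv i P x = 0].
Proof.
elim=> [c|{}m|j {}m {}P HP [dP hP zP]|{}m {}P Q _ [dP hP zP] _ [dQ hQ zQ]].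
- by rewrite pderiv_cst; split=> //; exact: HomogZero.
- by rewrite pderiv_cst; split=> //; exact: HomogZero.
- have dx x := is_derive_mul _ _ _ _ _ _ (is_derive_coord x (delta_mx 0 i) j)
    (derivableP (dP x)).
  have E : pderiv i (fun x => x 0 j * P x) =
      fun x => (if j == i then P x else 0) + x 0 j * pderiv i P x.
    apply/funext => x; rewrite /pderiv; have [_ ->] := dx x.
    by rewrite mxE eqxx /=; case: eqP => _; rewrite ?mul1r ?mul0r.
  rewrite E; split=> //.
  apply: HomogAdd; first by case: (j == i) => //; exact: HomogZero.
  case: m HP hP zP {dx E} => [|m] HP hP zP; last exact: HomogCoord.
  have -> : (fun x => x 0 j * pderiv i P x) = fun=> 0.
    by apply/funext => x; rewrite zP // mulr0.
  exact: HomogZero.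
- have dx x := is_derive_add _ _ _ _ _ _ (derivableP (dP x))
    (derivableP (dQ x)).
  have E : pderiv i (fun x => P x + Q x) =
      fun x => pderiv i P x + pderiv i Q x.
    by apply/funext => x; rewrite /pderiv; have [_ ->] := dx x.
  rewrite E; split=> [x||m0 x]; first by have [] := dx x.
  + exact: HomogAdd.
  + by rewrite zP // zQ // addr0.
Qed.

Definition smooth_profile_of g f :=
  (forall i t, derivable (derive1n i g) t 1) /\ (forall x, f x = g (radius x)).

(** The coefficients P_l satisfy P_l(i :: s) = x_i P_(l - 1)(s) + d_i P_l(s);
in particular they do not depend on f, which gives uniform constants. The sum
is truncated to size s <= 2l <= 2 size s by the vanishing clause. *)
Lemma pderivs_radial (s : seq 'I_d) : exists P : nat -> 'rV[R]_d -> R,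
  [/\ forall l, homog (l.*2 - size s) (P l),
      forall l, (l.*2 < size s)%N || (size s < l)%N -> P l = fun=> 0 &
      forall f g, smooth_profile_of g f -> forall x, x != 0 ->
        pderivs s f x =
        \sum_(l < (size s).+1) P l x * iter l (@Dop R) g (radius x)].
Proof.
elim: s => [|i s [P [hP zP EP]]].
  exists (fun l => if l == 0%N then fun=> 1 else fun=> 0); split => /=.
  - by case=> [|l]; [exact: HomogConst|exact: HomogZero].
  - by case.
  - by move=> f g [_ fg] x x0; rewrite big_ord1 /= mul1r.
exists (fun l x => (if l is l'.+1 then x 0 i * P l' x else 0) + pderiv i (P l) x).
have dP l := homog_derive _ _ i (hP l).
have zP' l : (l.*2 < (size s).+1)%N || ((size s).+1 < l)%N ->
  (fun x => (if l is l'.+1 then x 0 i * P l' x else 0) + pderiv i (P l) x) =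
  fun=> 0.
  move=> lS; have -> : pderiv i (P l) = fun=> 0.
    have [lE|lE] := eqVneq l.*2 (size s); last by rewrite zP ?pderiv_cst //; lia.
    apply/funext => x; have [_ _] := dP l; apply; lia.
  case: l lS => [|l] lS; first by apply/funext => x; rewrite addr0.
  rewrite zP; last lia.
  by apply/funext => x; rewrite mulr0 addr0.
split=> [l||f g fg x x0] //=.
  have [lS|Sl] := ltnP l.*2 (size s).+1.
    by rewrite zP' ?lS //; exact: HomogZero.
  apply: HomogAdd; last first.
    by have [_ + _] := dP l; rewrite subnS.
  case: l Sl => [|l] Sl; first exact: HomogZero.
  have [lS|Sl'] := ltnP l.*2 (size s).
    rewrite zP ?lS //.
    have -> : (fun x => x 0 i * 0 : R) = fun=> 0.
      by apply/funext => x; rewrite mulr0.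
    exact: HomogZero.
  have -> : (l.+1.*2 - (size s).+1 = (l.*2 - size s).+1)%N by lia.
  exact: HomogCoord.
have [gs _] := fg.
have nearE : \near x, \sum_(l < (size s).+1) P l x * iter l (@Dop R) g (radius x)
    = pderivs s f x.
  by apply: filterS (neq0_near _ x0) => y y0; rewrite (EP f g).
have r0 := radius_gt0 _ x0.
have dterm (l : nat) : is_derive x (delta_mx 0 i)
    (fun x => P l x * iter l (@Dop R) g (radius x))
    (pderiv i (P l) x * iter l (@Dop R) g (radius x) +
     x 0 i * P l x * iter l.+1 (@Dop R) g (radius x)).
  have [/(_ x)/derivableP dPl _ _] := dP l.
  have := is_derive_mul _ _ _ _ _ _ dPl (is_derive_comp_radius _ _ (delta_mx 0 i) _ x0
    (is_derive_Dop _ gs l _ r0)).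
  by move/is_derive_eq; apply; rewrite dot_delta /pderiv; ring.
rewrite -[LHS]/('D_(delta_mx 0 i) (pderivs s f) x).
have := near_eq_is_derive nearE (is_derive_bigsum _ _ _ _ _ _
  (fun l : 'I_(size s).+1 => dterm l)).
case=> _ ->; rewrite big_split /= addrC.
under [RHS]eq_bigr do rewrite mulrDl; rewrite big_split /=; congr (_ + _).
  by rewrite [RHS]big_ord_recl /= mul0r add0r.
rewrite [RHS]big_ord_recr /= [P (size s).+1]zP ?ltnSn ?orbT // pderiv_cst mul0r addr0.
by [].
Qed.

Lemma big_cons_tuple k (F : seq 'I_d -> R) :
  \sum_(s : k.+1.-tuple 'I_d) F s =
  \sum_(i < d) \sum_(s : k.-tuple 'I_d) F (i :: s).
Proof.
rewrite pair_big /=.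
rewrite (reindex (fun p : 'I_d * k.-tuple 'I_d => cons_tuple p.1 p.2)) //=.
exists (fun s : k.+1.-tuple 'I_d => (thead s, behead_tuple s)).
  by move=> [i s] _ /=; congr (_, _); exact/val_inj.
by move=> s _; apply/val_inj; rewrite [RHS](congr1 val (tuple_eta s)).
Qed.

(** For a fixed unit vector w the contraction of order k + 1 is the derivative in
the direction w of the contraction of order k; this derivative maps the scalar
product with w to 1 and h(r) to the scalar product times (D h)(r), which is
the situation of [hermite_sum]. *)
Lemma contraction_radial k w f g : smooth f -> smooth_profile_of g f ->
  sqnorm w = 1 -> forall x, x != 0 ->
  \sum_(s : k.-tuple 'I_d) (\prod_(i <- s) w 0 i) * pderivs s f x =
  \sum_(l < k.+1) (hermite k l)%:R * dot x w ^+ (l.*2 - k) *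
     iter l (@Dop R) g (radius x).
Proof.
move=> sf [gs fg] w1; elim: k => [|k IH] x x0.
  rewrite big_ord1 /= mul1r expr0 mul1r -fg (bigD1 [tuple]) //= big_nil mul1r.
  by rewrite big1 ?addr0 // => s; rewrite tuple0.
rewrite (big_cons_tuple k (fun s => (\prod_(i <- s) w 0 i) * pderivs s f x)).
have r0 := radius_gt0 _ x0.
pose h l := iter l (@Dop R) g (radius x).
have nearE : \near x,
    \sum_(l < k.+1) (hermite k l)%:R * dot x w ^+ (l.*2 - k) *
      iter l (@Dop R) g (radius x) =
    \sum_(s : k.-tuple 'I_d) (\prod_(i <- s) w 0 i) * pderivs s f x.
  by apply: filterS (neq0_near _ x0) => y y0; rewrite IH.
have ddot i : is_derive x (delta_mx 0 i) (dot^~ w) (w 0 i).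
  have := is_derive_bigsum _ (index_enum 'I_d) _ _ _ _ (fun j : 'I_d =>
    is_derive_mul _ _ _ _ _ _ (is_derive_coord x (delta_mx 0 i) j)
      (is_derive_cst (w 0 j) x (delta_mx 0 i))).
  move/is_derive_eq; apply.
  rewrite (bigD1 i) //= big1 ?addr0 => [|j ji].
    by rewrite mxE !eqxx mul1r mulr0 addr0.
  by rewrite mxE (negbTE ji) andbF mul0r mulr0 addr0.
have dterm i (l : nat) : is_derive x (delta_mx 0 i)
   (fun x => (hermite k l)%:R * dot x w ^+ (l.*2 - k) *
      iter l (@Dop R) g (radius x))
   ((hermite k l)%:R * (x 0 i * dot x w ^+ (l.*2 - k) * h l.+1 +
     w 0 i * (l.*2 - k)%:R * dot x w ^+ (l.*2 - k).-1 * h l)).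
  have := is_derive_mul _ _ _ _ _ _
    (is_derive_scale (hermite k l)%:R _ _ _ _ (is_derive_exp _ (l.*2 - k) _ _ _ (ddot i)))
    (is_derive_comp_radius _ _ (delta_mx 0 i) _ x0 (is_derive_Dop _ gs l _ r0)).
  by move/is_derive_eq; apply; rewrite dot_delta /h; ring.
have step i : \sum_(s : k.-tuple 'I_d)
      (\prod_(j <- i :: s) w 0 j) * pderivs (i :: s) f x =
    w 0 i * \sum_(l < k.+1) (hermite k l)%:R *
     (x 0 i * dot x w ^+ (l.*2 - k) * h l.+1 +
      w 0 i * (l.*2 - k)%:R * dot x w ^+ (l.*2 - k).-1 * h l).
  have [_ <-] := near_eq_is_derive nearE (is_derive_bigsum _ _ _ _ _ _
    (fun l : 'I_k.+1 => dterm i l)).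
  have dsum := is_derive_bigsum _ (index_enum (k.-tuple 'I_d)) _ x (delta_mx 0 i) _
    (fun s => is_derive_scale (\prod_(j <- s) w 0 j) _ _ _ _
      (derivableP ((sf s).2 i x))).
  have [_ ->] := dsum; rewrite mulr_sumr; apply: eq_bigr => s _.
  by rewrite big_cons mulrA.
rewrite (eq_bigr _ (fun i _ => step i)) (hermite_sum _ _ _ h).
under eq_bigr do rewrite mulr_sumr; rewrite exchange_big /=.
apply: eq_bigr => l _.
have -> : dot x w ^+ (l.*2 - k) * (dot x w * h l.+1) =
    \sum_(i < d) x 0 i * w 0 i * (dot x w ^+ (l.*2 - k) * h l.+1).
  by rewrite -mulr_suml -/(dot x w); ring.
have -> : (l.*2 - k)%:R * dot x w ^+ (l.*2 - k).-1 * h l =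
    \sum_(i < d) w 0 i ^+ 2 * ((l.*2 - k)%:R * dot x w ^+ (l.*2 - k).-1 * h l).
  by rewrite -mulr_suml -/(sqnorm w) w1 mul1r.
rewrite -big_split /= mulr_sumr; apply: eq_bigr => i _; ring.
Qed.

End Radial.

(** * Pointwise comparison away from the origin *)

Section Pointwise.
Context {R : realType} {d : nat}.
Implicit Types (x v w : 'rV[R]_d) (f : 'rV[R]_d -> R) (g : R -> R).

Lemma dotZD x a u b v : dot x (a *: u + b *: v) = a * dot x u + b * dot x v.
Proof.
rewrite /dot !mulr_sumr -big_split /=; apply: eq_bigr => i _.
by rewrite !mxE; ring.
Qed.

Lemma dotC x v : dot x v = dot v x.
Proof. by apply: eq_bigr => i _; rewrite mulrC. Qed.

Lemma sqnormZ x a : sqnorm (a *: x) = a ^+ 2 * sqnorm x.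
Proof.
by rewrite /sqnorm mulr_sumr; apply: eq_bigr => i _; rewrite mxE exprMn.
Qed.

Lemma dotxx x : dot x x = sqnorm x.
Proof. by []. Qed.

Lemma sqnorm_orthogonal x v a b : dot x v = 0 ->
  sqnorm (a *: x + b *: v) = a ^+ 2 * sqnorm x + b ^+ 2 * sqnorm v.
Proof.
move=> xv; rewrite -dotxx dotZD ![dot (_ + _) _]dotC !dotZD [dot v x]dotC xv.
by rewrite !dotxx; ring.
Qed.

(** In the plane of two coordinates, rotate x by a right angle; if x vanishes
there, take a coordinate vector. *)
Lemma exists_orthogonal_unit x : (2 <= d)%N ->
  exists2 v, dot x v = 0 & sqnorm v = 1.
Proof.
move=> d2.
have [i0 [i1 i01]] : exists i0 i1 : 'I_d, i0 != i1.
  by exists (Ordinal (ltnW d2)), (Ordinal d2).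
suff [v v0 xv] : exists2 v, v != 0 & dot x v = 0.
  have r0 := radius_gt0 _ v0; exists ((radius v)^-1 *: v + 0 *: v).
    by rewrite dotZD xv !mulr0 addr0.
  by rewrite scale0r addr0 sqnormZ -sqr_radius -exprMn mulVf ?gt_eqF // expr1n.
pose v := x 0 i1 *: delta_mx 0 i0 + (- x 0 i0) *: delta_mx 0 i1 : 'rV[R]_d.
have [v0|] := eqVneq v 0; last first.
  by exists v => //; rewrite dotZD !dot_delta; ring.
exists (delta_mx 0 i0).
  by apply/eqP => /matrixP/(_ 0 i0)/eqP; rewrite !mxE !eqxx oner_eq0.
have /matrixP/(_ 0 i1) := v0; rewrite !mxE !eqxx eq_sym (negbTE i01) /=.
by rewrite mulr0 add0r mulr1 dot_delta => /eqP; rewrite oppr_eq0 => /eqP.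
Qed.

(** This is where dimension at least 2 enters: w is a combination of x and of a
unit vector orthogonal to x. *)
Lemma exists_unit_direction x (t : R) : (2 <= d)%N -> x != 0 -> 0 <= t <= 1 ->
  exists2 w, sqnorm w = 1 & dot x w = t * radius x.
Proof.
move=> d2 x0 /andP[t0 t1]; have [v xv v1] := exists_orthogonal_unit x d2.
have r0 := radius_gt0 _ x0; have rn : radius x != 0 by rewrite gt_eqF.
have t2 : 0 <= 1 - t ^+ 2 by rewrite subr_ge0 expr_le1.
exists ((t / radius x) *: x + Num.sqrt (1 - t ^+ 2) *: v).
  rewrite sqnorm_orthogonal // v1 (sqr_sqrtr t2) -sqr_radius exprMn exprVn.
  by rewrite divfK ?expf_neq0 // mulr1 addrC subrK.
by rewrite dotZD xv dotxx -sqr_radius; field.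
Qed.

Lemma frobenius_grad_ge0 k f x : 0 <= frobenius_grad k f x.
Proof. exact: sqrtr_ge0. Qed.

Lemma pderivs_le_frobenius k f x (s : k.-tuple 'I_d) :
  `|pderivs s f x| <= frobenius_grad k f x.
Proof.
have S0 : 0 <= \sum_(s : k.-tuple 'I_d) pderivs s f x ^+ 2.
  by apply: sumr_ge0 => ? _; exact: sqr_ge0.
rewrite -(ler_pXn2r (n := 2)) ?nnegrE ?frobenius_grad_ge0 //.
rewrite real_normK ?num_real // /frobenius_grad sqr_sqrtr //.
by rewrite (bigD1 s) //= lerDl; apply: sumr_ge0 => ? _; exact: sqr_ge0.
Qed.

Lemma frobenius_le_sum k f x :
  frobenius_grad k f x <= \sum_(s : k.-tuple 'I_d) `|pderivs s f x|.
Proof.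
have S0 : 0 <= \sum_(s : k.-tuple 'I_d) `|pderivs s f x| by apply: sumr_ge0.
rewrite -(ler_pXn2r (n := 2)) ?nnegrE ?frobenius_grad_ge0 //.
rewrite /frobenius_grad sqr_sqrtr; last by apply: sumr_ge0 => ? _; exact: sqr_ge0.
rewrite [leRHS]expr2 mulr_suml; apply: ler_sum => s _.
rewrite -real_normK ?num_real // expr2; apply: ler_wpM2l => //.
by rewrite (bigD1 s) //= lerDl; apply: sumr_ge0.
Qed.

Lemma pderivs_upper (s : seq 'I_d) : exists2 C : R, 0 <= C &
  forall f g, smooth_profile_of g f -> forall x M, x != 0 ->
    (forall l, (size s <= l.*2)%N -> (l <= size s)%N ->
      `|radius x ^+ (l.*2 - size s) * iter l (@Dop R) g (radius x)| <= M) ->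
    `|pderivs s f x| <= C * M.
Proof.
have [P [hP zP EP]] := pderivs_radial (R := R) s.
have /choice[c Hc] l : exists c : R, 0 <= c /\
    forall x, `|P l x| <= c * radius x ^+ (l.*2 - size s).
  by have [c c0 Hc] := homog_bound _ _ (hP l); exists c.
exists (\sum_(l < (size s).+1) c l).
  by apply: sumr_ge0 => l _; have [] := Hc l.
move=> f g fg x M x0 HM; rewrite (EP _ _ fg x x0) mulr_suml.
have r0 : 0 <= radius x by exact: radius_ge0.
have M0 : 0 <= M by apply: le_trans (HM (size s) _ _) => //; lia.
apply: le_trans (ler_norm_sum _ _ _) _; apply: ler_sum => l _.
have [c0 cP] := Hc l; have [ls|sl] := ltnP l.*2 (size s).
  by rewrite zP ?ls // mul0r normr0 mulr_ge0.
rewrite normrM; apply: le_trans (ler_wpM2r _ (cP x)) _ => //.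
rewrite -mulrA; apply: ler_wpM2l => //.
have := HM l sl (ltn_ord l); congr (_ <= _).
by rewrite normrM ger0_norm // exprn_ge0.
Qed.

Lemma frobenius_upper k : exists2 C : R, 0 <= C &
  forall f g, smooth_profile_of g f -> forall x, x != 0 ->
    frobenius_grad k f x <=
    C * \sum_(j < (k./2).+1) `|derive1n (k - j.*2) (iter j (@Dop R) g) (radius x)|.
Proof.
have /choice[c Hc] (s : k.-tuple 'I_d) : exists c : R, 0 <= c /\
  forall f g, smooth_profile_of g f -> forall x M, x != 0 ->
    (forall l, (k <= l.*2)%N -> (l <= k)%N ->
      `|radius x ^+ (l.*2 - k) * iter l (@Dop R) g (radius x)| <= M) ->
    `|pderivs s f x| <= c * M.
  have [c c0 Hc] := pderivs_upper s; exists c; split => //.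
  by move: Hc; rewrite size_tuple.
have [C C0 HC] := hermite_system_ge (R := R) k.
exists ((\sum_s c s) * C) => [|f g fg x x0].
  by rewrite mulr_ge0 //; apply: sumr_ge0 => s _; have [] := Hc s.
apply: le_trans (frobenius_le_sum _ _ _) _; rewrite -mulrA mulr_suml.
apply: ler_sum => s _; have [_] := Hc s; apply; [exact: fg|exact: x0|].
have [gs _] := fg; have r0 := radius_gt0 _ x0.
apply: (HC _ _ _ (hermite_system_radial g _ k r0 gs)).
  by apply: sumr_ge0.
move=> j jk; have jk' : (j < (k./2).+1)%N by lia.
by rewrite (bigD1 (Ordinal jk')) //= lerDl; apply: sumr_ge0.
Qed.

(** With t the cosine of the angle between x and w, the contraction with w times
t^k is a polynomial in t^2 with coefficients hermite k l * r^(2l - k) D^l g (r).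
It is bounded by the Frobenius norm for all t in [0, 1], so interpolation
bounds its coefficients. *)
Lemma frobenius_lower k : (2 <= d)%N -> exists2 C : R, 0 <= C &
  forall f g, smooth f -> smooth_profile_of g f -> forall x, x != 0 ->
    forall j, (j.*2 <= k)%N ->
    `|derive1n (k - j.*2) (iter j (@Dop R) g) (radius x)|
      <= C * frobenius_grad k f x.
Proof.
move=> d2; have [C C0 HC] := hermite_system_le (R := R) k.
have [D D0 HD] := interpolation_bound (R := R) k.+1.
pose N : R := #|{: k.-tuple 'I_d}|%:R.
exists (C * (D * N)) => [|f g sf fg x x0 j jk].
  by rewrite !mulr_ge0 // ler0n.
have [gs _] := fg; have r0 := radius_gt0 _ x0.
have F0 := frobenius_grad_ge0 k f x.
rewrite -!mulrA.
apply: (HC _ _ _ (hermite_system_radial g _ k r0 gs)) => //.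
  by rewrite !mulr_ge0 // ler0n.
move=> l kl lk.
pose b l := radius x ^+ (l.*2 - k) * iter l (@Dop R) g (radius x).
have : `|(hermite k l)%:R * b l| <= D * (N * frobenius_grad k f x).
  apply: (HD (fun l => (hermite k l)%:R * b l)) => // s s01.
  have s0 : 0 <= s by case/andP: s01.
  pose t := Num.sqrt s; have ts : t ^+ 2 = s by rewrite sqr_sqrtr.
  have t01 : 0 <= t <= 1.
    by rewrite sqrtr_ge0 -sqrtr1 ler_sqrt //; case/andP: s01.
  have [w w1 xw] := exists_unit_direction x t d2 x0 t01.
  have -> : \sum_(i < k.+1) (hermite k i)%:R * b i * s ^+ i =
      t ^+ k * \sum_(s : k.-tuple 'I_d) (\prod_(i <- s) w 0 i) * pderivs s f x.
    rewrite (contraction_radial k w f g sf fg w1 x x0) mulr_sumr.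
    apply: eq_bigr => i _; have [ik|ki] := ltnP i.*2 k.
      by rewrite hermite_small // !mul0r mulr0.
    have -> : s ^+ i = t ^+ k * t ^+ (i.*2 - k).
      by rewrite -exprD subnKC // -mul2n exprM ts.
    by rewrite /b xw exprMn; ring.
  have t0 : 0 <= t by case/andP: t01.
  rewrite normrM ger0_norm ?exprn_ge0 // -[leRHS]mul1r.
  apply: ler_pM; rewrite ?exprn_ge0 //; first by apply: exprn_ile1; case/andP: t01.
  rewrite /N mulr_natl -sumr_const; apply: le_trans (ler_norm_sum _ _ _) _.
  apply: ler_sum => u _; rewrite normrM -[leRHS]mul1r; apply: ler_pM => //.
    rewrite normr_prod; rewrite big_tnth; apply: prodr_ile1 => i _; rewrite normr_ge0 /=.
    apply: le_trans (coord_le_radius w _) _.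
    by rewrite -(ler_pXn2r (n := 2)) ?nnegrE ?radius_ge0 // sqr_radius w1 expr1n.
  exact: pderivs_le_frobenius.
apply: le_trans; rewrite [leRHS]normrM normr_nat ler_peMl //.
by rewrite ler1n hermite_gt0.
Qed.

End Pointwise.

(** * Lebesgue measurability *)

Section LebesgueMeasurability.
Context {R : realType} {d : nat}.
Implicit Types (x a b : 'rV[R]_d) (i : 'I_d) (c : R) (U : set 'rV[R]_d).

Definition cap_coord i c x : 'rV[R]_d :=
  \row_j if j == i then Num.min (x 0 j) c else x 0 j.

Definition cup_coord i c x : 'rV[R]_d :=
  \row_j if j == i then Num.max (x 0 j) c else x 0 j.

Definition box_below i c (o : option ('rV[R]_d * 'rV[R]_d)) :=
  omap (fun ab => (ab.1, cap_coord i c ab.2)) o.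

Definition box_above i c (o : option ('rV[R]_d * 'rV[R]_d)) :=
  omap (fun ab => (cup_coord i c ab.1, ab.2)) o.

(** Cutting a box by a hyperplane orthogonal to a coordinate axis; either part may
be degenerate. *)
Lemma box_volume_split i c o :
  box_volume o = box_volume (box_below i c o) + box_volume (box_above i c o) :> R.
Proof.
case: o => [[a b]|] /=; last by rewrite addr0.
have rest (F : 'I_d -> R) : (forall j, j != i -> F j = Num.max 0 (b 0 j - a 0 j)) ->
    \prod_(j < d) F j =
    F i * \prod_(j < d | j != i) Num.max 0 (b 0 j - a 0 j).
  by move=> HF; rewrite (bigD1 i) //=; congr (_ * _); exact: eq_bigr.
rewrite !rest // => [|j ji|j ji]; rewrite ?mxE ?(negbTE ji) //.
rewrite eqxx -mulrDl; congr (_ * _).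
rewrite /Num.min /Num.max.
by case: ifPn; case: ifPn; case: ifPn; case: ifPn; case: ifPn; lra.
Qed.

Lemma halfspace_measurable i c :
  (lebesgue_outer_measure R d).-caratheodory [set x : 'rV[R]_d | x 0 i <= c].
Proof.
apply: le_caratheodory_measurable => X.
apply: le_ereal_inf_tmp => _ [B XB <-].
under eq_eseriesr do rewrite (box_volume_split i c) EFinD.
rewrite nneseriesD; try by move=> k _ _; exact: box_volume_ge0.
apply: leeD; apply: ereal_inf_lbound.
- exists (fun k => box_below i c (B k)) => //.
  move=> x [/XB[k _ Bx] /= xc]; exists k => //; move: Bx.
  case: (B k) => [[a b]|//] /= Bx j; rewrite mxE; case: eqP => [->|_] //.
  by have /andP[-> xb] := Bx i; rewrite le_min xb.
- exists (fun k => box_above i c (B k)) => //.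
  move=> x [/XB[k _ Bx] /= /negP]; rewrite -ltNge => xc; exists k => //; move: Bx.
  case: (B k) => [[a b]|//] /= Bx j; rewrite mxE; case: eqP => [->|_] //.
  by have /andP[ax ->] := Bx i; rewrite gt_max ax xc.
Qed.

Lemma box_measurable o : measurable (box o : set (lebesgue_space R d)).
Proof.
case: o => [[a b]|]; last exact: measurable0.
rewrite (_ : box _ = \bigcap_(i in [set: 'I_d])
    (~` [set x : 'rV[R]_d | x 0 i <= a 0 i] `&` [set x | x 0 i <= b 0 i])).
  apply: (@fin_bigcap_measurable _ (lebesgue_space R d)) => // i _.
  by apply: measurableI; [apply: measurableC|]; exact: halfspace_measurable.
apply/seteqP; split => x /= H i.
- by have /andP[ax xb] := H i; split => //; apply/negP; rewrite -ltNge.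
- by have [/negP] := H i I; rewrite -ltNge => -> ->.
Qed.

(** An open set is the union of the boxes with rational corners that it contains. *)
Lemma open_lebesgue_measurable U : open U ->
  measurable (U : set (lebesgue_space R d)).
Proof.
move=> oU.
pose rbox (q : 'rV[rat]_d * 'rV[rat]_d) : set 'rV[R]_d :=
  box (Some (map_mx ratr q.1, map_mx ratr q.2)).
pose F q : set 'rV[R]_d := if `[< rbox q `<=` U >] then rbox q else set0.
have -> : U = \bigcup_q F q.
  apply/seteqP; split => [x Ux|x [q _]]; last first.
    by rewrite /F; case: ifPn => // /asboolP; apply.
  have /nbhs_ballP[e /= e0 eU] : nbhs x U by exact: open_nbhs_nbhs.
  have /choice[qa Ha] i : exists q : rat, ratr q \in `](x 0 i - e), (x 0 i)[.
    by apply: rat_in_itvoo; rewrite ltrBlDr ltrDl.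
  have /choice[qb Hb] i : exists q : rat, ratr q \in `](x 0 i), (x 0 i + e)[.
    by apply: rat_in_itvoo; rewrite ltrDl.
  have Ha' i : x 0 i - e < ratr (qa i) < x 0 i by have := Ha i; rewrite in_itv.
  have Hb' i : x 0 i < ratr (qb i) < x 0 i + e by have := Hb i; rewrite in_itv.
  exists (\row_i qa i, \row_i qb i) => //; rewrite /F asboolT.
    move=> i; rewrite !mxE; have /andP[_ ->] := Ha' i.
    by have /andP[/ltW -> _] := Hb' i.
  move=> y Hy; apply: eU; split=> // i j; rewrite ord1 /ball /= ltr_norml.
  have := Hy j; rewrite !mxE => /andP[ay yb].
  by move: (Ha' j) (Hb' j) => /andP[? ?] /andP[? ?]; apply/andP; split; lra.
apply: (@countable_bigcupT_measurable _ (lebesgue_space R d)).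
  exact: countableP.
by move=> q; rewrite /F; case: ifP => _; [exact: box_measurable|exact: measurable0].
Qed.

(** The box with side s = min(e, 1) ending at the origin has volume
s^d <= s <= e. *)
Lemma lebesgue_outer_origin : (0 < d)%N -> lebesgue_outer [set (0 : 'rV[R]_d)] = 0%E.
Proof.
move=> d0; apply/eqP; rewrite eq_le lebesgue_outer_ge0 andbT.
apply/lee_addgt0Pr => e e0; rewrite add0e.
pose s := Num.min e 1; have s0 : 0 < s by rewrite lt_min e0 ltr01.
pose B (k : nat) : option ('rV[R]_d * 'rV[R]_d) :=
  if k is 0%N then Some (const_mx (- s), 0) else None.
have cB : box_cover [set (0 : 'rV[R]_d)] B.
  move=> _ ->; exists 0%N => // i; rewrite !mxE lexx andbT oppr_lt0 //.
apply: (@le_trans _ _ (\sum_(k <oo) (box_volume (B k))%:E)%E).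
  by apply: ereal_inf_lbound; exists B.
rewrite nneseries_recl //; last by move=> k _; exact: box_volume_ge0.
rewrite eseries0 ?adde0 => [|[|k] //].
rewrite lee_fin /=.
under eq_bigr do rewrite !mxE sub0r opprK max_r ?(ltW s0) //.
rewrite prodr_const card_ord; apply: (@le_trans _ _ s).
  case: d d0 => // m _; rewrite exprS ler_piMr ?(ltW s0) //.
  by apply: exprn_ile1; rewrite ?(ltW s0) // ge_min lexx orbT.
by rewrite ge_min lexx.
Qed.

Lemma origin_null : (0 < d)%N ->
  (lebesgue_measure_Rd R d).-negligible [set (0 : 'rV[R]_d)].
Proof.
move=> d0; exists [set (0 : 'rV[R]_d)]; split => //; last first.
  exact: lebesgue_outer_origin.
rewrite -[X in measurable X]setCK; apply: measurableC.
apply: open_lebesgue_measurable; rewrite openE => x /eqP x0.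
by apply: filterS (neq0_near _ x0) => y /eqP.
Qed.

Lemma ae_neq0 (P : 'rV[R]_d -> Prop) : (0 < d)%N -> (forall x, x != 0 -> P x) ->
  \forall x \ae lebesgue_measure_Rd R d, P x.
Proof.
move=> d0 HP; apply: negligibleS (origin_null d0) => x /= nP.
by apply: contrapT => /eqP x0; exact/nP/HP.
Qed.

(** A preimage of an open half-line is the union of an open set and a subset of
the null set of the origin, which is measurable by completeness. *)
Lemma continuous_off0_measurable (f : 'rV[R]_d -> R) : (0 < d)%N ->
  (forall x, x != 0 -> {for x, continuous f}) -> lebesgue_measurable f.
Proof.
move=> d0 cf.
apply: (measurability _ (measurable_realfun.RGenOInfty.measurableE R)).
move=> _ [_ [c ->] <-]; rewrite setTI.
set S := f @^-1` _.
have -> : S = [set x | x != 0 /\ c < f x] `|` (S `&` [set 0]).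
  apply/seteqP; split => x /=; rewrite /S /= in_itv /= andbT.
    by move=> cx; have [x0|x0] := eqVneq x 0; [right; split|left; split].
  by case=> [[]|[]].
apply: measurableU.
  apply: open_lebesgue_measurable; rewrite openE => x [x0 cx].
  near=> y; split; first by near: y; exact: neq0_near.
  by near: y; exact: (cf x x0 [set z | c < z] (lt_nbhsr cx)).
have : (lebesgue_measure_Rd R d).-negligible (S `&` [set 0]).
  by apply: negligibleS (origin_null d0) => x [].
exact: measure_is_complete_caratheodory.
Unshelve. all: by end_near. Qed.

End LebesgueMeasurability.

(** * Norms in the lattice *)

Section RadialSmooth.
Context {R : realType} {d : nat}.
Implicit Types (x : 'rV[R]_d) (f : 'rV[R]_d -> R).

Lemma is_derive_along f v (t a : R) : is_derive (t *: v) v f a ->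
  is_derive t 1 (fun s : R => f (s *: v)) a.
Proof.
move=> /is_derive_line df; apply/is_derive_line.
by under eq_fun do rewrite scalerDl [_%:A]mulr1.
Qed.

(** The derivatives of the profile are the partial derivatives of f in the first
direction, restricted to the first axis. *)
Lemma smooth_profile f : (0 < d)%N -> smooth f -> radial f ->
  smooth_profile_of (profile f) f.
Proof.
move=> d0 sf [g fg]; pose i0 := Ordinal d0.
have e1E : e1 R d = delta_mx 0 i0 by apply/matrixP => i j; rewrite !mxE ord1.
have dl m (t : R) : is_derive t 1 (fun s : R => pderivs (nseq m i0) f (s *: e1 R d))
    (pderivs (nseq m.+1 i0) f (t *: e1 R d)).
  apply: is_derive_along; rewrite /= /pderiv -e1E; apply: derivableP.
  by rewrite e1E; exact: (sf (nseq m i0)).2.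
have E m : derive1n m (profile f) = fun t : R => pderivs (nseq m i0) f (t *: e1 R d).
  elim: m => [//|m IH]; rewrite derive1nS IH; apply/funext => t.
  by rewrite derive1E; have [_ ->] := dl m t.
split=> [m t|x]; first by rewrite E; have [] := dl m t.
rewrite /profile !fg; congr g; rewrite [RHS]/Defs.radius (bigD1 i0) //= big1.
  by rewrite addr0 !mxE mulr1 sqrtr_sqr ger0_norm // radius_ge0.
move=> i ii0; rewrite !mxE; have -> : (val i == 0)%N = false.
  by apply/negbTE; apply: contra ii0 => /eqP iv; apply/eqP/val_inj.
by rewrite mulr0 expr0n.
Qed.

Lemma continuous_bigsum (I : Type) (r : seq I) (F : I -> 'rV[R]_d -> R) x :
  (forall i, {for x, continuous (F i)}) ->
  continuous_at x (fun y => \sum_(i <- r) F i y).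
Proof.
move=> cF; elim: r => [|i r IH].
  by under eq_fun do rewrite big_nil; exact: cst_continuous.
under eq_fun do rewrite big_cons.
exact: (@continuousD _ _ _ (F i) (fun y => \sum_(i <- r) F i y)).
Qed.

Lemma continuous_sqr f x : {for x, continuous f} ->
  {for x, continuous (fun y => f y ^+ 2)}.
Proof. by move=> cf; exact: (@continuousM _ _ f f). Qed.

Lemma continuous_sqrt_sumsq (I : Type) (r : seq I) (F : I -> 'rV[R]_d -> R) x :
  (forall i, {for x, continuous (F i)}) ->
  {for x, continuous (fun y => Num.sqrt (\sum_(i <- r) F i y ^+ 2))}.
Proof.
move=> cF; apply: (@continuous_comp _ _ _
  (fun y => \sum_(i <- r) F i y ^+ 2) (@Num.sqrt R)).
  by apply: continuous_bigsum => i; exact: continuous_sqr.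
exact: sqrt_continuous.
Qed.

Lemma radius_continuous : continuous (@radius R d).
Proof. by move=> x; apply: continuous_sqrt_sumsq => i; exact: coord_continuous. Qed.

Lemma frobenius_grad_continuous k f : smooth f -> continuous (frobenius_grad k f).
Proof. by move=> sf x; apply: continuous_sqrt_sumsq => s; exact: (sf s).1. Qed.

Lemma pderivs_outside (K : set 'rV[R]_d) f s : closed K ->
  (forall x, ~ K x -> f x = 0) -> forall x, ~ K x -> pderivs s f x = 0.
Proof.
move=> cK fK; elim: s => [|i s IH] x Kx /=; first exact: fK.
rewrite /pderiv (@near_eq_derive _ _ _ _ (fun=> 0)); first exact: derive_cst.
have oK : open (~` K) by exact: closed_openC.
by apply: filterS (open_nbhs_nbhs (conj oK Kx)) => y; exact: IH.
Qed.

Lemma frobenius_grad_Linfty_c k f : (0 < d)%N -> smooth f ->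
  compactly_supported f -> Linfty_c (frobenius_grad k f).
Proof.
move=> d0 sf [K cK fK]; have cF := frobenius_grad_continuous k f sf.
have K0 x : ~ K x -> frobenius_grad k f x = 0.
  move=> Kx; rewrite /frobenius_grad big1 ?sqrtr0 // => s _.
  rewrite (pderivs_outside K) ?expr0n //.
  exact: compact_closed (@norm_hausdorff _ _) cK.
split; first by apply: continuous_off0_measurable => // x _; exact: cF.
- have : compact (frobenius_grad k f @` K).
    by apply: continuous_compact => //; exact: continuous_subspaceT.
  move=> /compact_bounded[M [_ /(_ (M + 1))]].
  rewrite ltrDl ltr01 => /(_ isT) HM.
  exists (Num.max 0 (M + 1)) => x; rewrite le_max.
  have [Kx|Kx] := pselect (K x); last by rewrite K0 // normr0 lexx.
  by rewrite HM ?orbT //; exists x.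
- by exists K.
Qed.

Lemma radial_term_measurable (g : R -> R) m j : (0 < d)%N ->
  (forall i t, derivable (derive1n i g) t 1) ->
  lebesgue_measurable
    (fun x : 'rV[R]_d => derive1n m (iter j (@Dop R) g) (radius x)).
Proof.
move=> d0 gs; apply: continuous_off0_measurable => // x x0.
have r0 := radius_gt0 _ x0.
apply: (@continuous_comp _ _ _ (@radius R d) (derive1n m (iter j (@Dop R) g))).
  exact: radius_continuous.
apply: differentiable_continuous; apply/derivable1_diffP.
have J := jet_laurent_derive1n _ gs _ m (jet_laurent_Dop _ gs j).
by have [+ _] := jet_laurent_derive _ gs _ J; apply.
Qed.

End RadialSmooth.

Section LatticeNorm.
Context {R : realType} {d : nat}.
Variable X : banach_lattice R d.
Hypothesis d0 : (0 < d)%N.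
Implicit Types F G : 'rV[R]_d -> R.

(** Turns each pointwise estimate into membership and a norm estimate; the origin
is negligible. *)
Lemma lnorm_dominated F G (C : R) : Defs.carrier X F -> lebesgue_measurable G ->
  0 <= C -> (forall x, x != 0 -> `|G x| <= C * `|F x|) ->
  Defs.carrier X G /\ lnorm X G <= C * lnorm X F.
Proof.
move=> XF mG C0 GF; have XCF := carrierZ C XF.
have GCF : \forall x \ae lebesgue_measure_Rd R d, `|G x| <= `|C * F x|.
  by apply: ae_neq0 => // x x0; rewrite normrM (ger0_norm C0); exact: GF.
split; first exact: lattice_carrier XCF mG GCF.
apply: le_trans (lattice_norm XCF mG GCF) _.
by rewrite lnormZ // ger0_norm.
Qed.

Lemma lnorm_sum (I : Type) (r : seq I) (F : I -> 'rV[R]_d -> R) :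
  (forall i, Defs.carrier X (F i)) ->
  Defs.carrier X (fun x => \sum_(i <- r) F i x) /\
  lnorm X (fun x => \sum_(i <- r) F i x) <= \sum_(i <- r) lnorm X (F i).
Proof.
move=> XF; elim: r => [|i r [XS IH]].
  under eq_fun do rewrite big_nil; rewrite big_nil; split; first exact: carrier0.
  have E : (fun=> 0 * 0) = (fun=> 0) :> ('rV[R]_d -> R).
    by apply/funext => x; rewrite mul0r.
  by have := lnormZ 0 (carrier0 X); rewrite E normr0 mul0r => ->.
under eq_fun do rewrite big_cons; rewrite big_cons; split; first exact: carrierD.
by apply: le_trans (lnormD (XF i) XS) _; rewrite lerD2l.
Qed.

End LatticeNorm.

Theorem mainTheorem3 (R : realType) (d n : nat) (hd : (2 <= d)%N)
    (hn : (1 <= n)%N) (X : banach_lattice R d)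
    (hXinf : forall f : 'rV[R]_d -> R, Linfty_c f -> carrier X f)
    (hXloc : embeds_L1loc X) :
  exists C1 C2 : R, [/\ 0 < C1, 0 < C2 &
    forall f : 'rV[R]_d -> R,
      smooth f -> compactly_supported f -> radial f ->
      C1 * radial_norm X n (profile f) <= sobolev_norm X n f /\
      sobolev_norm X n f <= C2 * radial_norm X n (profile f)].
Proof.
have d0 : (0 < d)%N := ltnW hd.
have /choice[U HU] k : exists C : R, 0 <= C /\
  forall f g, smooth_profile_of g f -> forall x : 'rV[R]_d, x != 0 ->
    frobenius_grad k f x <=
    C * \sum_(j < (k./2).+1) `|derive1n (k - j.*2) (iter j (@Dop R) g) (radius x)|.
  by have [C C0 HC] := frobenius_upper (R := R) (d := d) k; exists C.
have /choice[L HL] k : exists C : R, 0 <= C /\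
  forall f g, smooth f -> smooth_profile_of g f -> forall x : 'rV[R]_d, x != 0 ->
    forall j, (j.*2 <= k)%N ->
    `|derive1n (k - j.*2) (iter j (@Dop R) g) (radius x)|
      <= C * frobenius_grad k f x.
  by have [C C0 HC] := frobenius_lower (R := R) k hd; exists C.
pose CL := 1 + \sum_(k < n.+1) \sum_(j < (k./2).+1) L k.
pose CU := 1 + \sum_(k < n.+1) U k.
have SL0 : 0 <= \sum_(k < n.+1) \sum_(j < (k./2).+1) L k.
  by apply: sumr_ge0 => k _; apply: sumr_ge0 => j _; have [] := HL k.
have SU0 : 0 <= \sum_(k < n.+1) U k by apply: sumr_ge0 => k _; have [] := HU k.
have CL0 : 0 < CL by rewrite /CL; lra.
have CU0 : 0 < CU by rewrite /CU; lra.
exists CL^-1, CU; split; rewrite ?invr_gt0 // => f sf cf rf.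
have sp := smooth_profile f d0 sf rf; have [gs _] := sp.
pose g := profile f.
pose A k j (x : 'rV[R]_d) := derive1n (k - j.*2) (iter j (@Dop R) g) (radius x).
have XF k : Defs.carrier X (frobenius_grad k f).
  by apply: hXinf; exact: frobenius_grad_Linfty_c.
have mA k j : lebesgue_measurable (A k j) by exact: radial_term_measurable.
have XA k j : (j.*2 <= k)%N -> Defs.carrier X (A k j) /\
    lnorm X (A k j) <= L k * lnorm X (frobenius_grad k f).
  move=> jk; have [L0 HLk] := HL k.
  apply: lnorm_dominated => // x x0.
  by rewrite (ger0_norm (frobenius_grad_ge0 _ _ _)); exact: HLk.
have jk2 k (j : 'I_(k./2).+1) : (j.*2 <= k)%N.
  by have := ltn_ord j; lia.
split.
  rewrite mulrC ler_pdivrMr // mulrC /radial_norm /sobolev_norm.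
  have F0 k : 0 <= lnorm X (frobenius_grad k f) by apply: lnorm_ge0.
  have S0 : 0 <= \sum_(k < n.+1) lnorm X (frobenius_grad k f).
    by apply: sumr_ge0.
  apply: (@le_trans _ _ (\sum_(k < n.+1) (\sum_(j < (k./2).+1) L k) *
      (\sum_(k < n.+1) lnorm X (frobenius_grad k f)))).
    apply: ler_sum => k _; rewrite mulr_suml; apply: ler_sum => j _.
    have [_ /le_trans] := XA k j (jk2 k j); apply.
    have [L0 _] := HL k; apply: ler_wpM2l => //.
    by rewrite (bigD1 k) //= lerDl; apply: sumr_ge0.
  by rewrite -mulr_suml; apply: ler_wpM2r => //; rewrite /CL lerDr ler01.
rewrite /radial_norm /sobolev_norm mulr_sumr; apply: ler_sum => k _.
have [U0 HUk] := HU k.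
have absA (j : 'I_(k./2).+1) : Defs.carrier X (fun x => `|A k j x|) /\
    lnorm X (fun x => `|A k j x|) <= 1 * lnorm X (A k j).
  have [XAj _] := XA k j (jk2 k j); apply: lnorm_dominated => // [|x _].
    exact: measurableT_comp (mA k j).
  by rewrite mul1r normr_id.
have [XS leS] := lnorm_sum X _ (index_enum 'I_(k./2).+1) (fun j x => `|A k j x|)
  (fun j => (absA j).1).
have [x x0|_ /le_trans] := lnorm_dominated X d0 _ (frobenius_grad k f) (U k) XS
  (carrier_measurable (XF k)) U0.
  rewrite !ger0_norm ?frobenius_grad_ge0 //; last by apply: sumr_ge0.
  exact: HUk.
apply; apply: ler_pM => //; first exact: lnorm_ge0.
  rewrite /CU (bigD1 k) //= addrCA lerDl addr_ge0 //.
  by apply: sumr_ge0 => i _; have [] := HU i.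
apply: le_trans leS _; apply: ler_sum => j _.
by have [_] := absA j; rewrite mul1r.
Qed.
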